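(* Let $a\geq 1$ be an integer and let $k$ be a positive integer with $k\leq a$. Let $\rho_1,\rho_2,\rho_3$ be the (real) roots of $f_a(x)=x^3-ax^2-(a+3)x-1$, and let $\mathcal{T}_a\subset\mathbb{R}^2$ be the cyclic polytope with vertices $(\rho_i,\rho_i^2)$, $i=1,2,3$, i.e. the triangle $\mathrm{conv}\{(\rho_1,\rho_1^2),(\rho_2,\rho_2^2),(\rho_3,\rho_3^2)\}$. Then \[ |k\mathcal{T}_a\cap \mathbb{Z}^2| = \frac{k^2(a^2+3a+9)}{2} + \theta(k), \qquad \theta(k)= \begin{cases} 1 & k\text{ even},\\ -1/2 & k \text{ odd}. \end{cases} \]
   Context: $k\mathcal{T}_a=\{kx : x\in\mathcal{T}_a\}$ denotes the dilation of $\mathcal{T}_a$ by the factor $k$. *)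

(* Defs.v *)
From mathcomp Require Import all_boot all_order all_algebra.
From mathcomp Require Import all_classical all_reals all_analysis.

Set Implicit Arguments.
Unset Strict Implicit.
Unset Printing Implicit Defensive.

Import Order.TTheory GRing.Theory Num.Theory.

Local Open Scope classical_set_scope.
Local Open Scope ring_scope.

Definition simplest_cubic (R : realType) (a : nat) : {poly R} :=
  'X^3 - a%:R *: 'X^2 - (a + 3)%:R *: 'X - 1.

Definition convex_hull (R : realType) (M : lmodType R) (A : set M) : set M :=
  smallest (@convex_set R M) A.

(* Row vectors of length 2 are indexed from 0, so this is (t, t ^+ 2). *)
Definition moment_point (R : realType) (t : R) : 'rV[R]_2 :=
  \row_(j < 2) t ^+ j.+1.

Definition cyclic_triangle (R : realType) (r1 r2 r3 : R) : set 'rV[R]_2 :=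
  convex_hull [set moment_point r1; moment_point r2; moment_point r3].

Definition dilation (R : realType) (M : lmodType R) (c : R) (A : set M) :
    set M :=
  [set c *: x | x in A].

Definition integer_lattice (R : realType) (n : nat) : set 'rV[R]_n :=
  [set p | forall j, p ord0 j \is a Num.int].
Arguments integer_lattice : clear implicits.

Definition theta (R : realType) (k : nat) : R :=
  if odd k then - (1 / 2) else 1.
Arguments theta : clear implicits.

(* Main.v *)
Require Import Defs.
From mathcomp Require Import all_boot all_order all_algebra.
From mathcomp Require Import finmap.
From mathcomp Require Import all_classical all_reals all_analysis.
From mathcomp Require Import ring lra zify.

(* The triangle has an integral symmetry of order three, because the roots are
   permuted by t |-> -1/(1+t) = t^2 - (a+1) t - 2. Applying it to the first
   coordinate x of a point (x, y) of k T_a yields three integers with sum k a;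
   translated by k they become the coordinates u, v, w, which sum to
   N = k (a + 3). If r is the largest root, the edges of k T_a are
     u <= r v + k (2 - 1/(1+r))   and its cyclic permutations.
   As k <= a these force u, v, w > -1, and r is so close to a + 1 that for
   natural numbers the inequality fails exactly when v < k and
   v (a+1) + 2k < u + [2v < k]. The points to be counted are hence those of a
   triangle of C(N+2, 2) points, deprived of three congruent disjoint corners
   of sum_(v < k) (k (a+1) - v (a+2) + [2v < k]) points each. *)

Import Order.TTheory GRing.Theory Num.Theory.

(** * Counting the points of a triangle deprived of three corners *)

Lemma sum_mem_interval (n lo hi : nat) :
  (hi <= n)%N -> (\sum_(u < n) (lo <= u < hi))%N = (hi - lo)%N.
Proof.
suff -> : (\sum_(u < n) (lo <= u < hi))%N = (minn n hi - lo)%N.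
  by move=> /minn_idPr ->.
elim: n => [|n IH]; first by rewrite big_ord0; lia.
by rewrite big_ord_recr /= IH; lia.
Qed.

Lemma double_sum_subn (m n : nat) :
  (n <= m.+1)%N -> (2 * (\sum_(v < n) (m - v)) + n ^ 2 = (2 * m + 1) * n)%N.
Proof.
elim: n => [|n IH] ltnm; first by rewrite big_ord0 !muln0 exp0n.
rewrite big_ord_recr /= -mulnn; have := IH (ltnW ltnm); rewrite -mulnn.
move: (\sum_(v < n) _)%N => s; lia.
Qed.

(** The Boolean [2 * v < k], read as 0 or 1, lowers the integer threshold by one where the real
    bound [r v + k (2 - 1/(1+r))] falls below [v (a+1) + 2k]. *)
Definition corner (a k u v : nat) : bool :=
  (v < k)%N && (v * a.+1 + 2 * k < u + (2 * v < k)%N)%N.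

Lemma card_set_pair (n : nat) (P : nat -> nat -> bool) :
  #|[set p : 'I_n * 'I_n | P p.1 p.2]| = (\sum_(v < n) \sum_(u < n) P u v)%N.
Proof.
rewrite -sum1_card big_mkcond /= exchange_big /= pair_big /=.
by apply: eq_bigr => p _; rewrite inE; case: (P _ _).
Qed.

Lemma card_simplex (N : nat) :
  (2 * #|[set p : 'I_N.+1 * 'I_N.+1 | (p.1 + p.2 <= N)%N]| = N.+1 * N.+2)%N.
Proof.
rewrite (card_set_pair _ (fun u v => u + v <= N)%N).
under eq_bigr => v _.
  have -> : (\sum_(u < N.+1) (u + v <= N))%N = (N.+1 - v)%N.
    rewrite -[RHS]subn0 -(@sum_mem_interval N.+1) ?leq_subr //.
    apply: eq_bigr => u _; have ltvN := ltn_ord v.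
    by congr (nat_of_bool _); lia.
  over.
have := double_sum_subn N.+1 N.+1 (leqnSn _); rewrite -mulnn.
move: (\sum_(v < N.+1) _)%N => s. lia.
Qed.

(** For [v < k] the corner meets column [v] in the interval from [v (a+1) + 2k + 1 - [2v < k]] to
    [N - v]. *)
Lemma sum_corner_column (a k v : nat) (N := (k * (a + 3))%N) :
  (k <= a)%N ->
  (\sum_(u < N.+1) (u + v <= N) && corner a k u v)%N =
  (if v < k then k * a.+1 + (2 * v < k)%N - v * a.+2 else 0)%N.
Proof.
move=> lek; rewrite /corner; case: ifP => vk; last first.
  by rewrite big1 // => u _; rewrite andbF.
set b := (2 * v < k)%N.
have e : (k * a.+1 + b - v * a.+2 =
          (N.+1 - v) - (v * a.+1 + 2 * k + 1 - b))%N by rewrite /b /N; nia.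
rewrite e -(@sum_mem_interval N.+1) ?leq_subr //.
by apply: eq_bigr => u _; congr (nat_of_bool _); rewrite /N /b; nia.
Qed.

Lemma sum_ltn_half (k n : nat) :
  (\sum_(v < n) (2 * v < k)%N)%N = minn n (uphalf k).
Proof.
elim: n => [|n IH]; first by rewrite big_ord0 min0n.
by rewrite big_ord_recr /= IH; lia.
Qed.

Lemma card_corner (a k : nat) (N := (k * (a + 3))%N) :
  (k <= a)%N ->
  (2 * #|[set p : 'I_N.+1 * 'I_N.+1 | (p.1 + p.2 <= N) && corner a k p.1 p.2]|
   + a.+2 * (k * k.-1) = 2 * k ^ 2 * a.+1 + 2 * uphalf k)%N.
Proof.
move=> lek.
rewrite (card_set_pair _ (fun u v => (u + v <= N) && corner a k u v)%N).
under eq_bigr do rewrite sum_corner_column //.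
rewrite -big_mkcond /=.
have -> : (\sum_(v < N.+1 | v < k) (k * a.+1 + (2 * v < k)%N - v * a.+2) =
           \sum_(v < k) (k * a.+1 + (2 * v < k)%N - v * a.+2))%N.
  rewrite -(big_ord_widen _
    (fun v => k * a.+1 + (2 * v < k)%N - v * a.+2)%N) //.
  by rewrite /N; nia.
(* The upper limit [n] is separated from the [k] of the summand, so that induction leaves the
   summand fixed. *)
suff H n : (n <= k)%N ->
  (2 * (\sum_(v < n) (k * a.+1 + (2 * v < k)%N - v * a.+2)) + a.+2 * (n * n.-1)
   = 2 * n * (k * a.+1) + 2 * \sum_(v < n) (2 * v < k)%N)%N.
  by have := H k (leqnn k); rewrite sum_ltn_half (minn_idPr _); nia.
elim: n => [|n IH] ltnk; first by rewrite !big_ord0 !muln0.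
have := IH (ltnW ltnk); rewrite !big_ord_recr /=.
(* As [n < k <= a], the truncated difference in the last summand is exact. *)
have : (n * a.+2 <= k * a.+1)%N by nia.
have -> : (a.+2 * (n.+1 * n) = a.+2 * (n * n.-1) + 2 * (n * a.+2))%N.
  by case: (n) => [|m] /=; lia.
lia.
Qed.

(** The first conjunct keeps the truncated subtractions in [w] exact, so that [u], [v], [w] sum to
    [k (a + 3)]. *)
Definition in_cut_simplex (a k u v : nat) : bool :=
  let w := (k * (a + 3) - u - v)%N in
  [&& (u + v <= k * (a + 3))%N, ~~ corner a k u v, ~~ corner a k v w
    & ~~ corner a k w u].

Lemma card_cut_simplex (a k : nat) (N := (k * (a + 3))%N) :
  (0 < k)%N -> (k <= a)%N ->
  (2 * #|[set p : 'I_N.+1 * 'I_N.+1 | in_cut_simplex a k p.1 p.2]| + 3 * odd k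
   = k ^ 2 * (a ^ 2 + 3 * a + 9) + 2)%N.
Proof.
move=> k_gt0 lek; pose pt := ('I_N.+1 * 'I_N.+1)%type.
pose K (A : nat -> nat -> bool) :=
  [set p : pt | (p.1 + p.2 <= N)%N && A p.1 p.2].
pose rot (p : pt) : pt := (p.2, inord (N - p.1 - p.2)).
have rotE (p : pt) : (rot p).2 = (N - p.1 - p.2)%N :> nat.
  by rewrite /= inordK //; lia.
have card_rot (A B : nat -> nat -> bool) :
    (forall u v, (u + v <= N)%N -> A u v -> B v (N - u - v)%N) ->
    (#|K A| <= #|K B|)%N.
  move=> AB; rewrite -(card_in_imset (f := rot)); last first.
    move=> p q; rewrite !inE => /andP[Tp _] /andP[Tq _] e.
    have e1 := congr1 fst e; have := congr1 (fun x => nat_of_ord x.2) e.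
    rewrite !rotE; case: p q e1 Tp Tq {e} => p1 p2 [q1 q2] /= -> Tp Tq e.
    by congr pair; apply: val_inj => /=; lia.
  apply/subset_leq_card/fintype.subsetP => _ /imsetP[p + ->].
  by rewrite !inE rotE => /andP[Tp /(AB _ _ Tp) ->]; rewrite andbT /=; lia.
pose K0 := K (corner a k).
pose K1 := K (fun u v => corner a k v (N - u - v)).
pose K2 := K (fun u v => corner a k (N - u - v) u).
(* The rotation [(u, v, w) -> (v, w, u)] injects each corner into another; going once around the
   cycle forces equal cardinalities. *)
have K02 : (#|K0| <= #|K2|)%N.
  by apply: card_rot => u v uv; rewrite (_ : (N - v - _ = u)%N); last lia.
have K21 : (#|K2| <= #|K1|)%N.
  by apply: card_rot => u v uv; rewrite (_ : (N - v - _ = u)%N); last lia.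
have K10 : (#|K1| <= #|K0|)%N by exact: card_rot.
set G := [set p | _].
(* The first corner requires [v < k], the second [v >= 2k]. *)
have corner_excl u v w : corner a k u v -> corner a k v w -> False.
  by rewrite /corner => /andP[v_lt_k _] /andP[_]; lia.
have cardT : (2 * (#|G| + #|K0| + #|K1| + #|K2|) = N.+1 * N.+2)%N.
  rewrite -card_simplex; congr (2 * _)%N.
  (* Cardinals become sums of indicators: each point of the simplex lies in exactly one of the four
     sets. *)
  rewrite -!sum1_card !(big_mkcond (fun i => i \in _)) /= -!big_split /=.
  apply: eq_bigr => p _; rewrite !inE /in_cut_simplex -/N.
  have [_|//] := leqP; move: (p.1 : nat) (p.2 : nat) => u v.
  move: (@corner_excl u v (N - u - v)%N) (@corner_excl v (N - u - v)%N u)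
    (@corner_excl (N - u - v)%N u v).
  case: (corner a k u v); case: (corner a k v _); case: (corner a k _ u)
    => //= h1 h2 h3; solve [by case: h1 | by case: h2 | by case: h3].
have cardK0 : (2 * #|K0| + a.+2 * (k * k.-1) =
               2 * k ^ 2 * a.+1 + 2 * uphalf k)%N := card_corner a k lek.
(* The term [3 * odd k] arises here: each of the three corners rounds [k / 2] up. *)
have k2 : (2 * uphalf k = k + odd k)%N by lia.
have kk : (k * k.-1 + k = k * k)%N by case: (k) => [|m] /=; lia.
have K1E : #|K1| = #|K0| by lia.
have K2E : #|K2| = #|K0| by lia.
move: cardT cardK0 kk k2; rewrite K1E K2E /N -!mulnn.
move: #|G| #|K0| (odd k : nat) (uphalf k) => g x o h.
move: (k * k.-1)%N => m; nia.
Qed.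

(** * The dilated triangle as an intersection of three half-planes *)

Local Open Scope classical_set_scope.
Local Open Scope ring_scope.

Lemma convex_set_comb (R : realType) (M : lmodType R) (X : set M) :
  convex_set X <->
  forall t x y, 0 <= t -> t <= 1 -> X x -> X y -> X (t *: x + (1 - t) *: y).
Proof.
split=> [cX t x y t0 t1 Xx Xy|cX x y t].
  have := cX x y (Itv01 t0 t1) (mem_set Xx) (mem_set Xy).
  by rewrite inE.
by rewrite !inE => Xx Xy; exact: (cX t%:num).
Qed.

Lemma convex_hull3 (R : realType) (M : lmodType R) (A B C : M) :
  convex_hull [set A; B; C] =
  [set v | exists s t u : R, [/\ 0 <= s, 0 <= t, 0 <= u, s + t + u = 1
                               & v = s *: A + t *: B + u *: C]].
Proof.
apply/seteqP; split.
  apply: smallest_sub.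
    apply/convex_set_comb => l v w l0 l1 /= [s [t [u [s0 t0 u0 e ->]]]].
    move=> [s' [t' [u' [s'0 t'0 u'0 e' ->]]]].
    exists (l * s + (1 - l) * s'), (l * t + (1 - l) * t'),
      (l * u + (1 - l) * u').
    split; try by rewrite addr_ge0 // mulr_ge0 // subr_ge0.
      transitivity (l * (s + t + u) + (1 - l) * (s' + t' + u')); first by ring.
      by rewrite e e'; ring.
    move: (1 - l) => m; rewrite !scalerDr !scalerDl !scalerA.
    rewrite addrACA; congr (_ + _).
    exact: addrACA.
  move=> v [[]|] -> /=; [exists 1, 0, 0|exists 0, 1, 0|exists 0, 0, 1];
    by rewrite ?scale0r ?scale1r ?addr0 ?add0r; split; rewrite ?ler01.
move=> _ [s [t [u [s0 t0 u0 e ->]]]] X [/convex_set_comb cX sX].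
have XA : X A by apply: sX; left; left.
have XB : X B by apply: sX; left; right.
have XC : X C by apply: sX; right.
(* The point is nested as a combination of [A] and a point of the segment [BC], whose weights are
   divided by [1 - s]. *)
have [s1|s1] := eqVneq s 1.
  have -> : t = 0 by lra.
  have -> : u = 0 by lra.
  by rewrite s1 !scale0r !addr0 scale1r.
have s'0 : 0 < 1 - s by rewrite subr_gt0 lt_neqAle s1; lra.
have -> : s *: A + t *: B + u *: C =
    s *: A + (1 - s) *: ((t / (1 - s)) *: B + (1 - t / (1 - s)) *: C).
  rewrite scalerDr !scalerA addrA; congr (_ + _ *: _ + _ *: _).
    by field; rewrite gt_eqF.
  have -> : u = 1 - s - t by rewrite -e; ring.
  by field; rewrite gt_eqF.
apply: (cX) => //; first lra.
by apply: cX => //; rewrite ?divr_ge0 ?ler_pdivrMr //; lra.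
Qed.

(** With [a] taken as the sum of the roots, everything is rational in [r] and identities fall to
    [field]. At a vertex [(t, t^2)] with [k = 1], the [z] coordinates are 1 plus the three roots, in
    cyclic order from [t]. *)
Lemma mem_dilated_triangle (R : realType) (r k : R) (p : 'rV[R]_2)
    (r2 := - (1 + r)^-1) (r3 := - (1 + r) / r) (a := r + r2 + r3)
    (x := p ord0 ord0) (y := p ord0 ord_max)
    (z0 := x + k) (z1 := y - (a + 1) * x - k) (z2 := k * (a + 3) - z0 - z1) :
  0 < r -> 0 < k ->
  dilation k (cyclic_triangle r r2 r3) p <->
  [/\ z0 <= r * z1 + k * (2 + r2), z1 <= r * z2 + k * (2 + r2)
    & z2 <= r * z0 + k * (2 + r2)].
Proof.
move=> r0 k0; have r10 : 0 < 1 + r by lra.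
have rn0 : r != 0 by rewrite gt_eqF.
have r1n0 : 1 + r != 0 by rewrite gt_eqF.
have kn0 : k != 0 by rewrite gt_eqF.
pose q := r ^+ 2 + r + 1; have q0 : 0 < q by rewrite /q; nra.
have qn0 : r ^+ 2 + r + 1 != 0 by rewrite gt_eqF.
(* The common value, for [k = 1], of the three edge forms at their opposite vertices. *)
pose D := q ^+ 2 / (r * (1 + r)).
have D0 : 0 < D by rewrite divr_gt0 ?exprn_gt0 ?mulr_gt0.
have kD0 : 0 <= k * D by rewrite ltW // mulr_gt0.
(* The barycentric coordinates of p are E z2 z0, E z1 z2 and E z0 z1, up to a
   common factor. *)
pose E u v := r * v + k * (2 + r2) - u.
rewrite /dilation /cyclic_triangle convex_hull3 /=; split.
  move=> [_ [s [t [u [s0 t0 u0 e ->]]]] ep].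
  have xE : x = k * (s * r + t * r2 + u * r3).
    by rewrite /x -ep !mxE /= !expr1.
  have yE : y = k * (s * r ^+ 2 + t * r2 ^+ 2 + u * r3 ^+ 2).
    by rewrite /y -ep !mxE /=.
  have sE : s = 1 - t - u by lra.
  have E0 : E z0 z1 = k * D * u.
    by rewrite /E /z1 /z0 xE yE sE /D /q /a /r2 /r3; field; rewrite rn0 r1n0.
  have E1 : E z1 z2 = k * D * t.
    rewrite /E /z2 /z1 /z0 xE yE sE /D /q /a /r2 /r3; field.
    by rewrite rn0 r1n0.
  have E2 : E z2 z0 = k * D * s.
    rewrite /E /z2 /z1 /z0 xE yE sE /D /q /a /r2 /r3; field.
    by rewrite rn0 r1n0.
  by split; rewrite -subr_ge0;
    [rewrite -/(E z0 z1) E0 | rewrite -/(E z1 z2) E1 | rewrite -/(E z2 z0) E2];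
    rewrite mulr_ge0.
move=> [E0 E1 E2].
pose s := E z2 z0 / (k * D); pose t := E z1 z2 / (k * D).
pose u := E z0 z1 / (k * D).
exists (s *: moment_point r + t *: moment_point r2 + u *: moment_point r3).
  exists s, t, u; split => //.
  1-3: by rewrite divr_ge0 // subr_ge0.
  rewrite /s /t /u /E /z2 /z1 /z0 /D /q /a /r2 /r3; field.
  by rewrite ?kn0 ?qn0 ?rn0 ?r1n0.
apply/rowP => j; rewrite !mxE.
case: j => -[|[|//]] jlt /=.
  have -> : Ordinal jlt = ord0 by exact: val_inj.
  rewrite -/x /s /t /u /E /z2 /z1 /z0 /D /q /a /r2 /r3; field.
  by rewrite ?kn0 ?qn0 ?rn0 ?r1n0.
have -> : Ordinal jlt = ord_max by exact: val_inj.
rewrite -/y /s /t /u /E /z2 /z1 /z0 /D /q /a /r2 /r3; field.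
by rewrite ?kn0 ?qn0 ?rn0 ?r1n0.
Qed.

(** * Edge inequalities at natural coordinates *)

Lemma ler_nat_addr (R : realType) (m n : nat) (h : R) :
  0 <= h -> h < 1 -> (m%:R <= n%:R + h) = (m <= n)%N.
Proof.
move=> h0 h1; apply/idP/idP => [|]; last by rewrite -(ler_nat R); lra.
by move=> le_m; rewrite -ltnS -(ltr_nat R) -natr1; lra.
Qed.

(** Since [r = a + 1 + 1/(1+r) + 1/r], the bound is the integer [v (a+1) + 2k] plus an error [h].
    For [v < k] this error lies strictly between -1 and 1, so only its sign matters. *)
Lemma edge_ineq_corner (R : realType) (r : R) (a k u v : nat)
    (r2 := - (1 + r)^-1) (r3 := - (1 + r) / r) :
  a%:R + 1 < r -> a%:R = r + r2 + r3 -> (0 < k)%N -> (k <= a)%N ->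
  (u + v <= k * (a + 3))%N ->
  (u%:R <= r * v%:R + k%:R * (2 + r2)) = ~~ corner a k u v.
Proof.
move=> ltr aE k_gt0 lek leN.
(* For [v >= k] the constraint [u + v <= k (a + 3)] alone implies the edge inequality. *)
have far : (k <= v -> u <= v * a.+1 + 2 * k)%N.
  by move=> /leq_mul/(_ (leqnn a.+1)); clear -leN; lia.
have M_gt0 : (0 < v * a.+1 + 2 * k)%N by clear -k_gt0; lia.
have a0 : 0 <= a%:R :> R by [].
have r0 : 0 < r by lra.
have r10 : 0 < 1 + r by lra.
pose d := (1 + r)^-1; pose e := r^-1.
have d0 : 0 < d by rewrite invr_gt0.
have e0 : 0 < e by rewrite invr_gt0.
have rE : r = a%:R + 1 + d + e.
  by rewrite aE /r2 /r3 /d /e; field; rewrite !gt_eqF.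
have ed : e = d + e * d by rewrite /e /d; field; rewrite !gt_eqF.
have lt_ad : a%:R * d < 1.
  by rewrite -[ltRHS](divff (x := 1 + r)) ?gt_eqF // ltr_pM2r //; lra.
have lt_ae : a%:R * e < 1.
  by rewrite -[ltRHS](divff (x := r)) ?gt_eqF // ltr_pM2r //; lra.
have lekR : k%:R <= a%:R :> R by rewrite ler_nat.
have v0 : 0 <= v%:R :> R by [].
have kd1 : k%:R * d < 1 by rewrite (le_lt_trans _ lt_ad) // ler_wpM2r // ltW.
pose h := v%:R * (d + e) - k%:R * d.
have -> : r * v%:R + k%:R * (2 + r2) = (v * a.+1 + 2 * k)%N%:R + h.
  by rewrite {1}rE /h /r2 -/d natrD !natrM -natr1; ring.
rewrite /corner; have [lt_vk|le_kv] /= := ltnP v k; last first.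
  have le_kvR : k%:R <= v%:R :> R by rewrite ler_nat.
  have h0 : 0 <= h.
    by rewrite subr_ge0 ler_pM // ?(ltW d0) //; lra.
  apply: (@le_trans _ _ (v * a.+1 + 2 * k)%N%:R); last by lra.
  by rewrite ler_nat far.
have lt_vkR : v%:R + 1 <= k%:R :> R by rewrite natr1 ler_nat.
have ve1 : v%:R * e < 1.
  by rewrite (le_lt_trans _ lt_ae) // ler_wpM2r ?(ltW e0) //; lra.
have ve0 : 0 <= v%:R * e by rewrite mulr_ge0 // ltW.
(* As [v e] lies in [[0, 1)], the sign of [h] is decided by the integer [2v - k]. *)
have hE : h = d * (2 * v%:R - k%:R + v%:R * e).
  by rewrite /h {1}ed; ring.
have [lt2|le2] /= := ltnP (2 * v) k.
  have lt2R : 2 * v%:R + 1 <= k%:R :> R by rewrite -natrM natr1 ler_nat.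
  have h0 : h < 0 by rewrite hE pmulr_rlt0 //; lra.
  have h1 : -1 <= h.
    have : 0 <= v%:R * (d + e) by rewrite mulr_ge0 //; lra.
    by rewrite /h; lra.
  have -> : (v * a.+1 + 2 * k)%N%:R + h = (v * a.+1 + 2 * k - 1)%N%:R + (1 + h).
    by rewrite natrB // [RHS]addrA subrK.
  rewrite ler_nat_addr; [|lra|lra].
  by move: M_gt0; clear; lia.
have le2R : k%:R <= 2 * v%:R :> R by rewrite -natrM ler_nat.
have h0 : 0 <= h by rewrite hE pmulr_rge0 //; lra.
have h1 : h < 1.
  by rewrite (le_lt_trans _ kd1) // hE mulrC ler_pM2r //; lra.
by rewrite ler_nat_addr // addn0 leqNgt.
Qed.

(* [y] is smallest at the vertex where both inequalities are tight. *)
Lemma coord_gtN1 (R : realType) (r k a x y z : R)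
    (r2 := - (1 + r)^-1) (r3 := - (1 + r) / r) :
  0 <= a -> a + 1 < r -> a = r + r2 + r3 -> 0 <= k -> k <= a ->
  x + y + z = k * (a + 3) ->
  x <= r * y + k * (2 + r2) -> z <= r * x + k * (2 + r2) -> -1 < y.
Proof.
move=> a0 ltr aE k0 lek sE xy zx.
have r0 : 0 < r by lra.
have r10 : 0 < 1 + r by lra.
have q0 : 0 < 1 + r + r ^+ 2 by nra.
have lt_ke : k / r < 1 by rewrite ltr_pdivrMr //; lra.
(* The value of [y] at that vertex is [- k / r], and [k <= a < r]. *)
have e : k * (a + 3) - k * (2 + r2) * (2 + r) = - (1 + r + r ^+ 2) * (k / r).
  by rewrite aE /r2 /r3; field; rewrite !gt_eqF.
have : (1 + r) * x <= (1 + r) * (r * y + k * (2 + r2)) by rewrite ler_pM2l.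
move: (k * (2 + r2)) e xy zx => K e xy zx xy'.
have : - (1 + r + r ^+ 2) * (k / r) <= (1 + r + r ^+ 2) * y by lra.
rewrite mulNr -mulrN ler_pM2l //; lra.
Qed.

Lemma natr_int_gtN1 (R : realType) (x : R) :
  x \is a Num.int -> -1 < x -> exists n : nat, x = n%:R.
Proof.
move=> /intrP[m ->] m1; apply/natrP; rewrite natrEint intr_int ler0z.
by move: m1; rewrite -(intrN R 1) ltr_int; lia.
Qed.

(** * Parametrizing and counting the lattice points *)

(** The inverse of the unimodular change of coordinates [u = x + k], [v = y - (a+1) x - k]. *)
Definition lattice_point (R : realType) (a k u v : nat) : 'rV[R]_2 :=
  \row_(j < 2) (if j == ord0 then u%:R - k%:R
                else v%:R + k%:R + (a%:R + 1) * (u%:R - k%:R)).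

Lemma lattice_point_inj (R : realType) (a k u v u' v' : nat) :
  lattice_point R a k u v = lattice_point R a k u' v' -> u = u' /\ v = v'.
Proof.
move=> /rowP e; have := e ord0; have := e ord_max; rewrite !mxE /= => e1 e0.
have uE : u = u' by apply/eqP; rewrite -(eqr_nat R); apply/eqP; lra.
rewrite uE in e1; split=> //.
by apply/eqP; rewrite -(eqr_nat R); apply/eqP; lra.
Qed.

Lemma mem_lattice_triangle (R : realType) (r : R) (a k : nat) (p : 'rV[R]_2)
    (r2 := - (1 + r)^-1) (r3 := - (1 + r) / r) :
  a%:R + 1 < r -> a%:R = r + r2 + r3 -> (0 < k)%N -> (k <= a)%N ->
  (dilation k%:R (cyclic_triangle r r2 r3) `&` integer_lattice R 2) p <->
  exists u v : nat, in_cut_simplex a k u v /\ p = lattice_point R a k u v.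
Proof.
move=> ltr aE k_gt0 lek; set N := (k * (a + 3))%N.
have a0 : 0 <= a%:R :> R by [].
have r0 : 0 < r by lra.
have k0 : 0 < k%:R :> R by rewrite ltr0n.
have NE : N%:R = k%:R * (a%:R + 3) :> R by rewrite natrM natrD.
have memE := @mem_dilated_triangle R r k%:R p r0 k0.
rewrite /= -/r2 -/r3 -aE in memE.
have nat_int n : n%:R \is a @Num.int R by rewrite rpred_nat.
have edgeE u v : (u + v <= N)%N ->
    (u%:R <= r * v%:R + k%:R * (2 + r2)) = ~~ corner a k u v.
  exact: edge_ineq_corner.
split.
  move=> [/memE[]]; set x := p _ _; set y := p _ _ => E0 E1 E2 pint.
  have xint : x \is a Num.int := pint ord0.
  have yint : y \is a Num.int := pint ord_max.
  have lekR : k%:R <= a%:R :> R by rewrite ler_nat.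
  (* Each coordinate is bounded below by the two edges meeting where it is smallest; an integer
     above -1, it is a natural number. *)
  have [||u uE] := @natr_int_gtN1 R (x + k%:R).
  - by rewrite rpredD ?nat_int.
  - by apply: (coord_gtN1 _ _ _ _ _ _ _ a0 ltr aE (ltW k0) lekR _ E2 E1); ring.
  have [||v vE] := @natr_int_gtN1 R (y - (a%:R + 1) * x - k%:R).
  - by rewrite !(rpredB, rpredM, rpredD, rpred1, nat_int).
  - by apply: (coord_gtN1 _ _ _ _ _ _ _ a0 ltr aE (ltW k0) lekR _ E0 E2); ring.
  have [||w wE] := @natr_int_gtN1 R (k%:R * (a%:R + 3) - (x + k%:R)
                                    - (y - (a%:R + 1) * x - k%:R)).
  - by rewrite !(rpredB, rpredM, rpredD, rpred1, nat_int).
  - by apply: (coord_gtN1 _ _ _ _ _ _ _ a0 ltr aE (ltW k0) lekR _ E1 E0); ring.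
  rewrite ?wE ?uE ?vE in E0 E1 E2.
  have sN : (u + v + w = N)%N.
    by apply/eqP; rewrite -(eqr_nat R) !natrD NE -uE -vE -wE; apply/eqP; ring.
  have [uvN vwN wuN wNE] : [/\ (u + v <= N)%N, (v + w <= N)%N, (w + u <= N)%N
      & (N - u - v = w)%N] by clear -sN; split; lia.
  exists u, v; split.
    by rewrite /in_cut_simplex -/N wNE; apply/and4P; split; rewrite -?edgeE.
  apply/rowP => j; rewrite mxE -uE -vE.
  case: j => -[|[|//]] jlt /=.
    have -> : Ordinal jlt = ord0 by exact: val_inj.
    by rewrite -/x; ring.
  have -> : Ordinal jlt = ord_max by exact: val_inj.
  by rewrite -/y /=; ring.
move=> [u [v [/and4P[]]]]; rewrite -/N => uvN C0 C1 C2 ->.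
set w := (N - u - v)%N in C1 C2 *.
have [uN vN vwN wuN] : [/\ (u <= N)%N, (v <= N - u)%N, (v + w <= N)%N
    & (w + u <= N)%N] by clear -uvN; split; lia.
have wE : w%:R = N%:R - u%:R - v%:R :> R by rewrite !natrB.
split; last first.
  move=> j; rewrite mxE; case: ifP => _; first by rewrite rpredB ?nat_int.
  by rewrite !(rpredB, rpredM, rpredD, rpred1, nat_int).
apply/(@mem_dilated_triangle R r k%:R _ r0 k0).
rewrite /= !mxE /= -/r2 -/r3 -aE.
rewrite subrK (_ : v%:R + _ + _ - _ - _ = v%:R); last by ring.
by rewrite -NE -wE !edgeE.
Qed.

Lemma card_lattice_triangle (R : realType) (r : R) (a k : nat)
    (r2 := - (1 + r)^-1) (r3 := - (1 + r) / r) :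
  a%:R + 1 < r -> a%:R = r + r2 + r3 -> (0 < k)%N -> (k <= a)%N ->
  let S := dilation k%:R (cyclic_triangle r r2 r3) `&` integer_lattice R 2 in
  finite_set S /\
  #|` fset_set S|%:R =
    k%:R ^+ 2 * (a%:R ^+ 2 + 3 * a%:R + 9) / 2 + theta R k :> R.
Proof.
move=> ltr aE k_gt0 lek S; pose N := (k * (a + 3))%N.
pose G := [set p : 'I_N.+1 * 'I_N.+1 | in_cut_simplex a k p.1 p.2]%SET.
pose f (p : 'I_N.+1 * 'I_N.+1) := lattice_point R a k p.1 p.2.
have f_inj : injective f.
  move=> [u v] [u' v'] /lattice_point_inj[/= /val_inj -> /val_inj ->] //.
have SE : S = [set` [fset f p | p in G]%fset].
  apply/seteqP; split=> p.
    move=> /(mem_lattice_triangle _ _ _ _ p ltr aE k_gt0 lek)[u [v [uv ->]]].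
    have /and4P[leN _ _ _] := uv.
    have ltu : (u < N.+1)%N by rewrite /N; lia.
    have ltv : (v < N.+1)%N by rewrite /N; lia.
    by apply/imfsetP; exists (Ordinal ltu, Ordinal ltv); rewrite //= inE.
  move=> /imfsetP[[u v] /=]; rewrite inE /= => uv ->.
  by apply/(mem_lattice_triangle _ _ _ _ _ ltr aE k_gt0 lek); exists u, v.
split; first by rewrite SE; exact: finite_fset.
rewrite SE set_fsetK card_imfset //= -cardE.
have := card_cut_simplex a k k_gt0 lek; rewrite -/N -/G.
move=> /(congr1 (fun n => n%:R : R)).
(* Halving [2 - 3 * odd k] gives 1 for even [k] and [-1/2] for odd [k]. *)
rewrite !(natrD, natrM, natrX) /theta; case: odd => /= e; lra.
Qed.

(** * Expressing the roots through the largest one *)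

Theorem theorem1p1 (R : realType) (a k : nat) (rho1 rho2 rho3 : R)
    (a_ge1 : (1 <= a)%N) (k_gt0 : (0 < k)%N) (k_le_a : (k <= a)%N)
    (rho_roots : simplest_cubic R a =
       ('X - rho1%:P) * ('X - rho2%:P) * ('X - rho3%:P)) :
  let S := dilation k%:R (cyclic_triangle rho1 rho2 rho3)
             `&` integer_lattice R 2 in
  finite_set S /\
  #|` fset_set S|%:R =
    k%:R ^+ 2 * (a%:R ^+ 2 + 3 * a%:R + 9) / 2 + theta R k :> R.
Proof.
have horner_roots x : x ^+ 3 - a%:R * x ^+ 2 - (a%:R + 3) * x - 1 =
    (x - rho1) * (x - rho2) * (x - rho3).
  have := congr1 (horner^~ x) rho_roots.
  rewrite /simplest_cubic.
  rewrite !(hornerD, hornerN, hornerM, hornerZ, hornerXn, hornerX, hornerC).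
  by rewrite (natrD _ a 3) => <-.
clear rho_roots.
have cyclic_triangleC x y z :
    cyclic_triangle x y z = cyclic_triangle y x z :> set 'rV[R]_2.
  by rewrite /cyclic_triangle (setUC [set moment_point x]).
have cyclic_triangleAC x y z :
    cyclic_triangle x y z = cyclic_triangle x z y :> set 'rV[R]_2.
  by rewrite /cyclic_triangle -!setUA (setUC [set moment_point y]).
have a1 : 1 <= a%:R :> R by rewrite (ler_nat R 1).
(* The cubic takes the negative value [-(2a + 3)] at [a + 1], impossible if all roots were at most
   [a + 1]. *)
have [i lt_rho] : exists i : 'I_3, a%:R + 1 < nth 0 [:: rho1; rho2; rho3] i.
  apply: contrapT => no_i.
  have le_rho i : nth 0 [:: rho1; rho2; rho3] (i : 'I_3) <= a%:R + 1.
    by rewrite leNgt; apply/negP => lt_i; apply: no_i; exists i.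
  have := le_rho (inord 0); have := le_rho (inord 1); have := le_rho (inord 2).
  rewrite !inordK //= => le3 le2 le1.
  have : 0 <= (a%:R + 1 - rho1) * (a%:R + 1 - rho2) * (a%:R + 1 - rho3).
    by rewrite !mulr_ge0 // subr_ge0.
  by rewrite -horner_roots; nra.
wlog i0 : rho1 rho2 rho3 i horner_roots lt_rho / i = ord0.
  move=> H; case: i lt_rho => -[|[|[|//]]] ilt /= lt_rho.
  - by apply: (H _ _ _ ord0).
  - rewrite cyclic_triangleC; apply: (H _ _ _ ord0) => // x.
    by rewrite horner_roots; ring.
  - rewrite cyclic_triangleAC cyclic_triangleC; apply: (H _ _ _ ord0) => // x.
    by rewrite horner_roots; ring.
move: lt_rho; rewrite {}i0 /= => {i} lt_rho.
have rho1_gt0 : 0 < rho1 by lra.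
have rho11_gt0 : 0 < 1 + rho1 by lra.
have root1 : rho1 ^+ 3 - a%:R * rho1 ^+ 2 - (a%:R + 3) * rho1 - 1 = 0.
  by rewrite horner_roots subrr !mul0r.
(* The equation of the root [rho1], solved for [a], in which it is linear. *)
have aE : a%:R = rho1 - (1 + rho1)^-1 + - (1 + rho1) / rho1.
  have q0 : rho1 ^+ 2 + rho1 != 0 by rewrite gt_eqF //; nra.
  apply: (mulIf q0); transitivity (rho1 ^+ 3 - 3 * rho1 - 1); first by lra.
  by field; rewrite !gt_eqF.
have sumE : rho1 + rho2 + rho3 = a%:R.
  (* The second difference at -1, 0, 1 isolates the coefficient of [x^2]. *)
  have := horner_roots 0; have := horner_roots 1.
  by have := horner_roots (-1); lra.
have root2 : (- (1 + rho1)^-1 - rho1) * (- (1 + rho1)^-1 - rho2) *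
             (- (1 + rho1)^-1 - rho3) = 0.
  by rewrite -horner_roots aE; field; rewrite !gt_eqF.
have d0 : 0 < (1 + rho1)^-1 by rewrite invr_gt0.
(* The root [-1/(1 + rho1)] is negative, hence differs from [rho1]; up to a swap it is [rho2], and
   the sum of the roots then fixes [rho3]. *)
wlog rho2E : rho2 rho3 horner_roots sumE root2 / rho2 = - (1 + rho1)^-1.
  move=> H; move/eqP: (root2).
  rewrite !mulf_eq0 !subr_eq0 => /orP[/orP[|]|] /eqP e.
  - lra.
  - exact: H.
  - rewrite cyclic_triangleAC; apply: H => //.
    + by move=> x; rewrite horner_roots mulrAC.
    + by rewrite addrAC.
    + by rewrite mulrAC.
have -> : rho3 = - (1 + rho1) / rho1 by rewrite rho2E in sumE; lra.
by rewrite rho2E; apply: card_lattice_triangle.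
Qed.
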